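(* Let $A_1,\dots,A_m$ be real $n\times n$ matrices and define the ellipsoid approximation $$\hat\rho(A_1,\dots,A_m)=\Big[\inf_{X,\tau}\{\tau:\ \tau X\succeq A_iXA_i^T,\ i=1,\dots,m,\ X\succ 0\}\Big]^{1/2}.$$ Then $$\frac{1}{\sqrt m}\,\hat\rho(A_1,\dots,A_m)\;\le\;\rho(A_1,\dots,A_m)\;\le\;\hat\rho(A_1,\dots,A_m).$$
   Context: For a finite set of real $n\times n$ matrices the joint spectral radius is $$\rho(A_1,\dots,A_m)=\limsup_{k\to+\infty}\ \max_{\sigma\in\{1,\dots,m\}^k}\|A_\sigma\|^{1/k},\qquad A_\sigma=A_{\sigma_k}\cdots A_{\sigma_2}A_{\sigma_1},$$ where $\|\cdot\|$ is any matrix norm (the value does not depend on the choice). In the infimum, $\tau$ ranges over $\mathbb{R}$ and $X$ over real symmetric $n\times n$ matrices; $X\succ 0$ means that $X$ is positive definite, and $Y\succeq Z$ means that $Y-Z$ is positive semidefinite. *)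

(* Defs.v *)
From mathcomp Require Import all_boot all_order all_algebra.
From mathcomp Require Import all_classical all_reals all_analysis.

Set Implicit Arguments.
Unset Strict Implicit.
Unset Printing Implicit Defensive.

Import Order.TTheory GRing.Theory Num.Theory.

Local Open Scope classical_set_scope.
Local Open Scope ring_scope.

(* Any vector-space norm on 'M[R]_n; submultiplicativity is not required. *)
Record is_matrix_norm (R : realType) (n : nat) (N : 'M[R]_n -> R) : Prop :=
  IsMatrixNorm {
    matrix_norm_triangle : forall A B : 'M[R]_n, N (A + B) <= N A + N B;
    matrix_norm_scale : forall (c : R) (A : 'M[R]_n), N (c *: A) = `|c| * N A;
    matrix_norm_eq0 : forall A : 'M[R]_n, N A = 0 -> A = 0 }.

(* The sequence is reversed so that the first letter of [s] acts first:
   [mxword A [:: s1; ...; sk]] is A sk *m ... *m A s1. *)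
Definition mxword (R : realType) (n m : nat) (A : 'I_m -> 'M[R]_n)
    (s : seq 'I_m) : 'M[R]_n :=
  \big[mulmx/1%:M]_(i <- rev s) A i.

(* The default value 0 of the maximum is harmless when 0 < m, as the terms are
   nonnegative; so is the value at k = 0, which does not affect the limsup. *)
Definition jsr_seq (R : realType) (n m : nat) (N : 'M[R]_n -> R)
    (A : 'I_m -> 'M[R]_n) (k : nat) : R :=
  \big[Num.max/0]_(s : k.-tuple 'I_m) (N (mxword A s) `^ (k%:R^-1)).

Definition joint_spectral_radius (R : realType) (n m : nat)
    (N : 'M[R]_n -> R) (A : 'I_m -> 'M[R]_n) : \bar R :=
  limn_esup (fun k => (jsr_seq N A k)%:E).

Definition posdefmx (R : realType) (n : nat) (X : 'M[R]_n) : Prop :=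
  X \is symmetricmx /\
  forall x : 'cV[R]_n, x != 0 -> 0 < (x^T *m X *m x) 0 0.

Definition possemidefmx (R : realType) (n : nat) (X : 'M[R]_n) : Prop :=
  X \is symmetricmx /\
  forall x : 'cV[R]_n, 0 <= (x^T *m X *m x) 0 0.

Definition loewner_ge (R : realType) (n : nat) (Y Z : 'M[R]_n) : Prop :=
  possemidefmx (Y - Z).

Definition ellipsoid_feasible (R : realType) (n m : nat)
    (A : 'I_m -> 'M[R]_n) (X : 'M[R]_n) (tau : R) : Prop :=
  posdefmx X /\
  forall i : 'I_m, loewner_ge (tau *: X) (A i *m X *m (A i)^T).

Definition ellipsoid_approx (R : realType) (n m : nat)
    (A : 'I_m -> 'M[R]_n) : \bar R :=
  sqrte (ereal_inf [set tau%:E | tau in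
    [set tau : R | exists X : 'M[R]_n, ellipsoid_feasible A X tau]]).

(* Main.v *)
Require Import Defs.
From HB Require Import structures.
From mathcomp Require Import all_boot all_order all_algebra.
From mathcomp Require Import all_classical all_reals all_analysis.
From mathcomp Require Import lra.

Set Implicit Arguments.
Unset Strict Implicit.
Unset Printing Implicit Defensive.

Import Order.TTheory GRing.Theory Num.Theory.
Import numFieldNormedType.Exports.

Local Open Scope classical_set_scope.
Local Open Scope ring_scope.

(** Both bounds compare the given norm of a product [W] of [k] of the matrices
    with a quadratic form, up to constants that do not depend on [k].  A constant
    is absorbed by replacing the growth rate with a slightly larger one
    ([geometric_domination]), so it disappears in the limsup.

    Upper bound.  If [X > 0] and [A_i X A_i^T <= tau X] for all [i], then
    iterating gives [W X W^T <= tau^k X] ([mxword_contraction]).  Since [X] is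
    coercive ([posdefmx_coercive]), the entries of [W] are O(sqrt(tau)^k), so the
    joint spectral radius is at most [sqrt tau] ([jsr_le_sqrt_feasible]).

    Lower bound.  Let the joint spectral radius be less than [c].  The factor [m]
    comes from replacing the [m] constraints by one: with
    [L Y = \sum_i A_i Y A_i^T], every [X >= 0] satisfies [A_i X A_i^T <= L X], so
    it suffices to find [X > 0] with [L X <= tau X].  Now [L^k 1] is the sum of
    [W W^T] over the [m^k] words of length [k], each of which is eventually below
    [c^(2k) 1], whence [L^k 1 <= tau^k 1] for [tau = m c^2] and some [k > 0].  For
    such a [k] the truncated resolvent
    [X = \sum_(j < k) tau^-j L^j 1] works, because
    [tau X - L X = tau (1 - tau^-k L^k 1)] telescopes
    ([partial_resolvent_feasible]).  Hence the squared ellipsoid approximation is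
    at most [m c^2] ([feasible_of_jsr_lt]). *)

(** * Growth rates and upper limits *)

(** Constants from norm comparisons do not change an exponential growth rate:
    [C * (a / b)^k] tends to 0. *)
Lemma geometric_domination (R : realType) (a b C : R) : 0 <= a -> a < b ->
  exists K, forall k, (K <= k)%N -> C * a ^+ k <= b ^+ k.
Proof.
move=> a0 ab; have b0 : 0 < b by exact: le_lt_trans ab.
have cvg0 : C * (a / b) ^+ k @[k --> \oo] --> C * 0.
  apply: cvgMr; apply: cvg_expr.
  by rewrite ger0_norm ?divr_ge0 ?(ltW b0)// ltr_pdivrMr ?mul1r.
rewrite mulr0 in cvg0.
have /(_ _ 1 ltr01) [K _ KP] := cvgr_lt 0 cvg0.
exists K => k /KP /ltW; rewrite expr_div_n mulrA ler_pdivrMr ?exprn_gt0//.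
by rewrite mul1r.
Qed.

Lemma limn_esup_lt_eventually (R : realType) (u : nat -> \bar R) (c : \bar R) :
  (limn_esup u < c)%E -> exists K, forall k, (K <= k)%N -> (u k < c)%E.
Proof.
move=> /ereal_inf_lt [_ [V [K _ KV] <-] supc]; exists K => k Kk.
by apply: le_lt_trans supc; apply: ereal_sup_ubound; exists k => //; exact: KV.
Qed.

Lemma limn_esup_le_eventually (R : realType) (u : nat -> \bar R)
    (c : \bar R) K :
  (forall k, (K <= k)%N -> (u k <= c)%E) -> (limn_esup u <= c)%E.
Proof.
move=> uc; apply: ge_ereal_inf; exists (ereal_sup (u @` [set k | (K <= k)%N])).
  by exists [set k | (K <= k)%N] => //; exists K.
by apply: ge_ereal_sup => _ [k /= Kk <-]; exact: uc.
Qed.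

(** * Comparison of homogeneous functions and norms *)

(** The minimum over the unit sphere, which is compact in finite dimension, is
    attained and therefore positive; homogeneity spreads the bound to all
    vectors.  Degree 1 serves for norms and degree 2 for quadratic forms. *)
Lemma homogeneous_lower_bound (R : realType) (p d : nat) (f : 'rV[R]_p -> R) :
  continuous f ->
  (forall c u, f (c *: u) = `|c| ^+ d.+1 * f u) ->
  (forall u, u != 0 -> 0 < f u) ->
  exists2 l, 0 < l & forall u, l * `|u| ^+ d.+1 <= f u.
Proof.
move=> fcont fhom fpos.
pose S : set 'rV[R]_p := [set u | `|u| = 1].
have normS u : u != 0 -> S (`|u|^-1 *: u).
  move=> u0; rewrite /S /= normrZ normfV normr_id mulVf//.
  by rewrite normr_eq0.
have f0 : f 0 = 0 by rewrite -(scale0r 0) fhom normr0 expr0n mul0r.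
have [l l0 lS] : exists2 l, 0 < l & forall u, S u -> l <= f u.
  (* The sphere is empty when [p = 0]; any [l] then works. *)
  have [->|S0] := eqVneq S set0; first by exists 1.
  have Scompact : compact S.
    apply: bounded_closed_compact.
      exists 1; split; first exact: num_real.
      by move=> x x1 u /= ->; exact: ltW.
    have -> : S = (@Num.norm _ _) @^-1` [set 1 : R] by [].
    apply: preimage_closed; last exact: closed_eq.
    by move=> u _; exact: norm_continuous.
  have [c cS cmin] := EVT_min_rV (proj1 (set0P S) S0)
    Scompact (continuous_subspaceT fcont).
  exists (f c); last by move=> u uS; apply: cmin; rewrite inE.
  apply: fpos; apply/eqP => c0; move: cS.
  by rewrite c0 inE /S /= normr0 => /eqP; rewrite eq_sym oner_eq0.
exists l => // u; have [->|u0] := eqVneq u 0.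
  by rewrite normr0 expr0n mulr0 f0.
have nu : 0 < `|u| by rewrite normr_gt0.
have := lS _ (normS _ u0); rewrite fhom normfV normr_id exprVn mulrC.
by rewrite ler_pdivlMr ?exprn_gt0.
Qed.

Lemma continuous_sumr (R : realType) (T : topologicalType) (I : finType)
    (f : I -> T -> R) :
  (forall i, continuous (f i)) -> continuous (fun x => \sum_i f i x).
Proof.
by move=> fc; apply: continuous_big => //; exact: add_continuous.
Qed.

Lemma lipschitz_bound_continuous (R : realType) (V : normedModType R)
    (f : V -> R) (C : R) :
  (forall u v, `|f u - f v| <= C * `|u - v|) -> continuous f.
Proof.
move=> lip u; apply/cvgrPdist_lt => e e0; near=> v.
apply: le_lt_trans (lip u v) _.
apply: le_lt_trans (_ : (`|C| + 1) * `|u - v| < _).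
  by rewrite ler_wpM2r// ler_wpDr// ler_norm.
rewrite mulrC -ltr_pdivlMr ?ltr_wpDl//.
near: v; apply: cvgr_dist_lt; first exact: cvg_id.
by rewrite divr_gt0 ?ltr_wpDl.
Unshelve. all: by end_near. Qed.

Lemma rV_entry_le_norm (R : realType) p (u : 'rV[R]_p) j : `|u 0 j| <= `|u|.
Proof.
rewrite [leRHS]/Num.Def.normr/= mx_normrE.
by apply: le_bigmax (fun ij : 'I_1 * 'I_p => `|u ij.1 ij.2|) (0, j).
Qed.

Section matrix_norm.
Variables (R : realType) (n : nat) (N : 'M[R]_n -> R).
Hypothesis normN : is_matrix_norm N.

Lemma matrix_norm0 : N 0 = 0.
Proof. by rewrite -(scale0r 0) (matrix_norm_scale normN) normr0 mul0r. Qed.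

Lemma matrix_normN B : N (- B) = N B.
Proof. by rewrite -scaleN1r (matrix_norm_scale normN) normrN1 mul1r. Qed.

Lemma matrix_norm_ge0 B : 0 <= N B.
Proof.
have := matrix_norm_triangle normN B (- B).
by rewrite subrr matrix_norm0 matrix_normN; lra.
Qed.

Lemma matrix_norm_sum (I : finType) (F : I -> 'M[R]_n) :
  N (\sum_i F i) <= \sum_i N (F i).
Proof.
apply: (big_ind2 (fun B b => N B <= b)) => //; first by rewrite matrix_norm0.
move=> B b B' b' Bb Bb'; apply: le_trans (matrix_norm_triangle normN _ _) _.
exact: lerD.
Qed.

(** The easy half of the equivalence of norms: expand [B] in the basis of
    elementary matrices and use the triangle inequality. *)
Lemma matrix_norm_le_entries : exists2 C : R, 0 <= C & forall (B : 'M[R]_n) b,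
  (forall i j, `|B i j| <= b) -> N B <= C * b.
Proof.
exists (\sum_i \sum_j N (delta_mx i j)).
  by apply: sumr_ge0 => i _; apply: sumr_ge0 => j _; exact: matrix_norm_ge0.
move=> B b Bb; rewrite {1}[B]matrix_sum_delta mulr_suml.
apply: le_trans (matrix_norm_sum _) _; apply: ler_sum => i _.
rewrite mulr_suml; apply: le_trans (matrix_norm_sum _) _.
apply: ler_sum => j _; rewrite (matrix_norm_scale normN) mulrC.
by rewrite ler_wpM2l ?matrix_norm_ge0.
Qed.

Lemma matrix_norm_continuous : continuous (N \o vec_mx : 'rV[R]_(n * n) -> R).
Proof.
have [C C0 CP] := matrix_norm_le_entries.
have lip u v : `|N (vec_mx u) - N (vec_mx v)| <= C * `|u - v|.
  have le1 u' v' : N (vec_mx u') - N (vec_mx v') <= C * `|u' - v'|.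
    rewrite lerBlDl; apply: le_trans (_ : N (vec_mx v' + vec_mx (u' - v')) <= _).
      by rewrite -linearD addrC subrK.
    apply: le_trans (matrix_norm_triangle normN _ _) _; rewrite lerD2l.
    by apply: CP => i j; rewrite mxE; exact: rV_entry_le_norm.
  by rewrite ler_norml le1 andbT lerNl opprB distrC le1.
exact: lipschitz_bound_continuous lip.
Qed.

(** The half that needs compactness.  Matrices are flattened to row vectors, for
    which closed bounded sets are compact. *)
Lemma entries_le_matrix_norm : exists2 C : R, 0 <= C & forall (B : 'M[R]_n) i j,
  `|B i j| <= C * N B.
Proof.
have [||l l0 lP] := @homogeneous_lower_bound R (n * n) 0 (N \o vec_mx)
  matrix_norm_continuous.
- by move=> c u /=; rewrite linearZ/= (matrix_norm_scale normN) expr1.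
- move=> u u0 /=; rewrite lt_neqAle matrix_norm_ge0 andbT eq_sym.
  apply: contra_neq u0 => /(matrix_norm_eq0 normN) u0.
  by rewrite -[u]vec_mxK u0 linear0.
exists l^-1 => [|B i j]; first by rewrite invr_ge0 ltW.
rewrite ler_pdivlMl//; apply: le_trans (_ : l * `|mxvec B| ^+ 1 <= _).
  by rewrite ler_pM2l// expr1 -mxvecE; exact: rV_entry_le_norm.
by apply: le_trans (lP _) _; rewrite /= mxvecK.
Qed.

End matrix_norm.

(** * Quadratic forms *)

Lemma symmetricmxP (R : fieldType) n (X : 'M[R]_n) :
  reflect (X^T = X) (X \is symmetricmx).
Proof.
rewrite is_hermitianmxE expr0 scale1r map_mx_id// eq_sym.
exact: eqP.
Qed.

Definition qform (R : realType) n (X : 'M[R]_n) (x : 'cV[R]_n) : R :=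
  (x^T *m X *m x) 0 0.

Section qform.
Variables (R : realType) (n : nat).
Implicit Types (X Y B : 'M[R]_n) (x : 'cV[R]_n).

Lemma qformD X Y x : qform (X + Y) x = qform X x + qform Y x.
Proof. by rewrite /qform mulmxDr mulmxDl mxE. Qed.

Lemma qformB X Y x : qform (X - Y) x = qform X x - qform Y x.
Proof. by rewrite /qform mulmxBr mulmxBl !mxE. Qed.

Lemma qformZ c X x : qform (c *: X) x = c * qform X x.
Proof. by rewrite /qform -scalemxAr -scalemxAl mxE. Qed.

Lemma qform_sum (I : finType) (F : I -> 'M[R]_n) x :
  qform (\sum_i F i) x = \sum_i qform (F i) x.
Proof. by rewrite /qform mulmx_sumr mulmx_suml summxE. Qed.

(** A congruence acts on the form by substitution in the vector; every Loewner
    inequality below is moved through a product of matrices in this way. *)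
Lemma qform_congr B X x : qform (B *m X *m B^T) x = qform X (B^T *m x).
Proof. by rewrite /qform trmx_mul trmxK !mulmxA. Qed.

Lemma qform1 x : qform 1%:M x = \sum_i x i 0 ^+ 2.
Proof.
by rewrite /qform mulmx1 mxE; apply: eq_bigr => i _; rewrite mxE expr2.
Qed.

Lemma sqr_entry_le_qform1 x i : x i 0 ^+ 2 <= qform 1%:M x.
Proof.
by rewrite qform1 (bigD1 i)//= lerDl sumr_ge0// => j _; exact: sqr_ge0.
Qed.

Lemma qform1_gt0 x : x != 0 -> 0 < qform 1%:M x.
Proof.
move=> x0; rewrite lt_neqAle eq_sym andbC qform1 sumr_ge0/=; last first.
  by move=> i _; exact: sqr_ge0.
apply: contra_neq x0 => sum0; apply/matrixP => i j; rewrite ord1 mxE.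
have := sqr_entry_le_qform1 x i; rewrite qform1 sum0 => xi.
by apply/eqP; rewrite -sqrf_eq0 eq_le xi sqr_ge0.
Qed.

(** Each coordinate of [B^T x] is a sum of [n] terms, each at most [b] times the
    Euclidean norm of [x], and there are [n] coordinates.  The constant is crude:
    any bound depending only on [n] would do. *)
Lemma qform1_le_entries B b x : (forall i j, `|B i j| <= b) ->
  qform (B *m 1%:M *m B^T) x <= n%:R ^+ 3 * b ^+ 2 * qform 1%:M x.
Proof.
move=> Bb; rewrite qform_congr qform1.
set q := qform 1%:M x.
have q0 : 0 <= q by rewrite /q qform1 sumr_ge0// => i _; exact: sqr_ge0.
have entry_le j : ((B^T *m x) j 0) ^+ 2 <= n%:R ^+ 2 * b ^+ 2 * q.
  have b0 : 0 <= b by exact: le_trans (Bb j j).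
  rewrite -(sqr_sqrtr q0) -!exprMn -real_normK ?num_real//.
  rewrite lerXn2r ?nnegrE ?mulr_ge0 ?sqrtr_ge0//.
  rewrite mxE; apply: le_trans (ler_norm_sum _ _ _) _.
  rewrite -mulrA -[n in n%:R]card_ord mulr_natl -sumr_const.
  apply: ler_sum => i _; rewrite normrM mxE ler_pM//.
  by rewrite -sqrtr_sqr ler_sqrt// sqr_entry_le_qform1.
apply: le_trans (_ : \sum_(j < n) n%:R ^+ 2 * b ^+ 2 * q <= _).
  exact: ler_sum.
by rewrite sumr_const card_ord -[leLHS]mulr_natl [in leRHS]exprS !mulrA.
Qed.

End qform.

(** The form is continuous, homogeneous of degree 2 and positive off 0, so
    [homogeneous_lower_bound] applies. *)
Lemma posdefmx_coercive (R : realType) n (X : 'M[R]_n) : posdefmx X ->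
  exists2 l : R, 0 < l & forall (x : 'cV[R]_n) i, l * x i 0 ^+ 2 <= qform X x.
Proof.
move=> [_ Xpos].
have [|||l l0 lP] :=
  @homogeneous_lower_bound R n 1 (fun u => qform X u^T).
- suff -> : (fun u : 'rV[R]_n => qform X u^T)
      = fun u => \sum_j (\sum_i u 0 i * X i j) * u 0 j.
    apply: continuous_sumr => j u.
    apply: continuousM; last exact: coord_continuous.
    have := @continuous_sumr R 'rV[R]_n 'I_n (fun i v => v 0 i * X i j).
    apply=> i v; apply: continuousM; first exact: coord_continuous.
    exact: cst_continuous.
  apply/funext => u; rewrite /qform trmxK mxE; apply: eq_bigr => j _.
  by rewrite !mxE.
- move=> c u; rewrite /qform !trmxK linearZ/= -!scalemxAl -scalemxAr !mxE.
  by rewrite mulrA real_normK ?num_real// expr2.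
- by move=> u u0; apply: Xpos; rewrite trmx_eq0.
exists l => // x i; rewrite -[in leRHS](trmxK x); apply: le_trans (lP _).
rewrite ler_pM2l// -real_normK ?num_real// lerXn2r ?nnegrE//.
by apply: le_trans (rV_entry_le_norm _ i); rewrite mxE.
Qed.

(** * Products of the matrices and the ellipsoid constraints *)

Section words.
Variables (R : realType) (n m : nat) (A : 'I_m -> 'M[R]_n).
Implicit Types (X : 'M[R]_n) (x : 'cV[R]_n).

Lemma mxword_nil : mxword A [::] = 1%:M.
Proof. by rewrite /mxword big_nil. Qed.

Lemma mxword_rcons s a : mxword A (rcons s a) = A a *m mxword A s.
Proof. by rewrite /mxword rev_rcons big_cons. Qed.

(** The constraints are preserved by congruence, so prepending a factor on the
    left of the product costs one more factor [tau]. *)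
Lemma mxword_contraction X tau : ellipsoid_feasible A X tau -> 0 <= tau ->
  forall s x, qform (mxword A s *m X *m (mxword A s)^T) x
    <= tau ^+ size s * qform X x.
Proof.
move=> [_ feas] tau0; elim/last_ind => [|s a IH] x.
  by rewrite mxword_nil trmx1 mulmx1 mul1mx expr0 mul1r.
rewrite mxword_rcons trmx_mul !mulmxA -2!(mulmxA (A a)) qform_congr.
apply: le_trans (IH _) _; rewrite size_rcons exprSr -mulrA.
rewrite ler_wpM2l ?exprn_ge0// -qform_congr -qformZ -subr_ge0 -qformB.
exact: (feas a).2.
Qed.

Lemma feasible_ge0 X tau : (0 < n)%N -> (0 < m)%N ->
  ellipsoid_feasible A X tau -> 0 <= tau.
Proof.
move=> n0 m0 [[_ Xpos] /(_ (Ordinal m0)) [_ feas]].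
pose x : 'cV[R]_n := const_mx 1.
have x0 : x != 0.
  apply/eqP => /matrixP /(_ (Ordinal n0) 0); rewrite !mxE => /eqP.
  by rewrite oner_eq0.
have X0 y : 0 <= qform X y.
  have [->|/Xpos/ltW//] := eqVneq y 0.
  by rewrite /qform mulmx0 mxE.
have := feas x; rewrite -/(qform _ x) qformB qformZ qform_congr subr_ge0.
by move=> /(le_trans (X0 _)); rewrite pmulr_lge0//; exact: Xpos.
Qed.

(** One application of this completely positive operator dominates each single
    constraint map [Y |-> A i *m Y *m (A i)^T] on positive semidefinite [Y]. *)
Definition ellipsoid_op (Y : 'M[R]_n) : 'M[R]_n :=
  \sum_i A i *m Y *m (A i)^T.

Lemma ellipsoid_op_is_linear : linear ellipsoid_op.
Proof.
move=> c X Y; rewrite /ellipsoid_op scaler_sumr -big_split/=.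
apply: eq_bigr => i _.
by rewrite mulmxDr mulmxDl -scalemxAr -scalemxAl.
Qed.

HB.instance Definition _ := GRing.isLinear.Build R 'M[R]_n 'M[R]_n _
  ellipsoid_op ellipsoid_op_is_linear.

Lemma qform_ellipsoid_op Y x :
  qform (ellipsoid_op Y) x = \sum_i qform Y ((A i)^T *m x).
Proof.
by rewrite qform_sum; apply: eq_bigr => i _; rewrite qform_congr.
Qed.

Lemma iter_ellipsoid_op_sym k : (iter k ellipsoid_op 1%:M)^T =
  iter k ellipsoid_op 1%:M.
Proof.
elim: k => [|k IH] /=; first by rewrite trmx1.
rewrite [LHS]linear_sum; apply: eq_bigr => i _ /=.
by rewrite !trmx_mul trmxK IH mulmxA.
Qed.

Lemma iter_ellipsoid_op_ge0 k x : 0 <= qform (iter k ellipsoid_op 1%:M) x.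
Proof.
elim: k x => [|k IH] x /=.
  by rewrite qform1 sumr_ge0// => i _; exact: sqr_ge0.
by rewrite qform_ellipsoid_op sumr_ge0.
Qed.

(** [iter k ellipsoid_op 1] is the sum of [W W^T] over the [m ^ k] words [W] of
    length [k]; the induction peels off the last letter and never forms this
    sum. *)
Lemma iter_ellipsoid_op_le k b x :
  (forall s, size s = k ->
    qform (mxword A s *m 1%:M *m (mxword A s)^T) x <= b) ->
  qform (iter k ellipsoid_op 1%:M) x <= m%:R ^+ k * b.
Proof.
elim: k x => [|k IH] x wb.
  have := wb [::] erefl.
  by rewrite mxword_nil trmx1 !mulmx1 expr0 mul1r.
rewrite [iter _ _ _]/= qform_ellipsoid_op exprS -mulrA mulr_natl.
rewrite -[in X in _ *+ X](card_ord m) -sumr_const.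
apply: ler_sum => i _; apply: IH => s sk.
have := wb (rcons s i); rewrite size_rcons sk => /(_ erefl).
rewrite mxword_rcons trmx_mul !mulmxA -2!(mulmxA (A i)).
by rewrite (qform_congr (A i)).
Qed.

(** With [L = ellipsoid_op], the full series of [tau^-k L^k 1] would solve
    [L X = tau (X - 1)].  Stopping after [K] replaces [1] by
    [1 - tau^-(K+1) L^(K+1) 1], which the hypothesis keeps nonnegative, so no
    convergence is needed. *)
Lemma partial_resolvent_feasible tau K : 0 < tau ->
  (forall x, qform (iter K.+1 ellipsoid_op 1%:M) x
             <= tau ^+ K.+1 * qform 1%:M x) ->
  ellipsoid_feasible A
    (\sum_(k < K.+1) tau ^- k *: iter k ellipsoid_op 1%:M) tau.
Proof.
move=> tau0 tail; set X := \sum_(k < _) _.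
have Xsym : X^T = X.
  rewrite /X [LHS]linear_sum; apply: eq_bigr => k _.
  by rewrite linearZ/= iter_ellipsoid_op_sym.
have Xge1 x : qform 1%:M x <= qform X x.
  rewrite qform_sum big_ord_recl/= expr0 invr1 scale1r lerDl.
  apply: sumr_ge0 => k _; rewrite qformZ mulr_ge0//.
    by rewrite invr_ge0 exprn_ge0// ltW.
  exact: (iter_ellipsoid_op_ge0 k.+1).
have X0 x : 0 <= qform X x.
  apply: le_trans (Xge1 x).
  by rewrite qform1 sumr_ge0// => i _; exact: sqr_ge0.
have opX : ellipsoid_op X
    = tau *: (X - 1%:M + tau ^- K.+1 *: iter K.+1 ellipsoid_op 1%:M).
  (* [G] has one more term than [X]: dropping its last term gives [X], dropping
     its first term [1] gives [ellipsoid_op X] divided by [tau]. *)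
  pose G := \sum_(k < K.+2) tau ^- k *: iter k ellipsoid_op 1%:M.
  have GX : X + tau ^- K.+1 *: iter K.+1 ellipsoid_op 1%:M = G.
    by rewrite /G [RHS]big_ord_recr.
  have -> : X - 1%:M + tau ^- K.+1 *: iter K.+1 ellipsoid_op 1%:M = G - 1%:M.
    by rewrite -GX addrAC.
  rewrite /G big_ord_recl/= expr0 invr1 scale1r addrC addKr scaler_sumr.
  rewrite linear_sum; apply: eq_bigr => k _.
  by rewrite linearZ/= scalerA exprS invfM mulVKf ?gt_eqF.
have opXle x : qform (ellipsoid_op X) x <= tau * qform X x.
  rewrite opX qformZ ler_pM2l// qformD qformB qformZ.
  have : tau ^- K.+1 * qform (iter K.+1 ellipsoid_op 1%:M) x <= qform 1%:M x.
    by rewrite ler_pdivrMl ?exprn_gt0.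
  by lra.
split.
  split; first exact/symmetricmxP.
  by move=> x x0; apply: lt_le_trans (Xge1 x); exact: qform1_gt0.
move=> i; split.
  apply/symmetricmxP; rewrite linearB linearZ/= Xsym.
  by rewrite !trmx_mul trmxK Xsym mulmxA.
move=> x; rewrite -/(qform _ x) qformB qformZ subr_ge0.
apply: le_trans (opXle x); rewrite qform_ellipsoid_op (bigD1 i)//= qform_congr.
by rewrite lerDl sumr_ge0.
Qed.

End words.

(** * The joint spectral radius *)

Section jsr.
Variables (R : realType) (n m : nat) (N : 'M[R]_n -> R) (A : 'I_m -> 'M[R]_n).
Hypothesis normN : is_matrix_norm N.

(** Clearing the [k]-th roots in the definition of the sequence. *)
Lemma jsr_seq_leP k c : (0 < k)%N -> 0 <= c ->
  jsr_seq N A k <= c <-> (forall s, size s = k -> N (mxword A s) <= c ^+ k).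
Proof.
move=> k0 c0.
have kR : k%:R != 0 :> R by rewrite pnatr_eq0 -lt0n.
have root_expr (a : R) : 0 <= a -> (a ^+ k) `^ k%:R^-1 = a.
  by move=> a0; rewrite -powR_mulrn// -powRrM divff// powRr1.
have expr_root (a : R) : 0 <= a -> (a `^ k%:R^-1) ^+ k = a.
  by move=> a0; rewrite -powR_mulrn ?powR_ge0// -powRrM mulVf// powRr1.
have N0 := matrix_norm_ge0 normN.
split=> [/bigmax_leP[_ le_c] s sk|le_c].
  rewrite -(expr_root _ (N0 _)) lerXn2r ?nnegrE ?powR_ge0//.
  have ts : size s == k by exact/eqP.
  exact: (le_c (Tuple ts)).
apply/bigmax_leP; split=> // s _; rewrite -(root_expr c)//.
apply: ge0_ler_powR; rewrite ?nnegrE ?invr_ge0 ?exprn_ge0//.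
by apply: le_c; rewrite size_tuple.
Qed.

Lemma jsr_ge0 : (0 <= joint_spectral_radius N A)%E.
Proof.
apply: limf_esup_ge0 => [/filter_not_empty//|k]; rewrite lee_fin.
rewrite /jsr_seq; elim/big_ind: _ => // [x y x0 _|s _]; last exact: powR_ge0.
by rewrite le_max x0.
Qed.

(** Row [i] of a product [W] is [W^T e_i], whose value under the form [X] is at
    most [tau^k] times that of [e_i]; coercivity of [X] turns this into a bound
    on the entries of [W]. *)
Lemma jsr_le_sqrt_feasible X tau : ellipsoid_feasible A X tau -> 0 <= tau ->
  (joint_spectral_radius N A <= (Num.sqrt tau)%:E)%E.
Proof.
move=> feas tau0.
have [l l0 lP] := posdefmx_coercive feas.1.
have [C C0 CP] := matrix_norm_le_entries normN.
pose e (i : 'I_n) : 'cV[R]_n := delta_mx i 0.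
have Xge0 x : 0 <= qform X x.
  have [->|/feas.1.2/ltW//] := eqVneq x 0.
  by rewrite /qform mulmx0 mxE.
pose Q := \sum_i qform X (e i).
have Q0 : 0 <= Q by exact: sumr_ge0.
have word_le s : N (mxword A s)
    <= C * Num.sqrt (Q / l) * Num.sqrt tau ^+ size s.
  rewrite -mulrA; apply: CP => i j.
  rewrite -(ler_pXn2r (ltn0Sn 1)) ?nnegrE ?mulr_ge0 ?exprn_ge0 ?sqrtr_ge0//.
  rewrite real_normK ?num_real// exprMn -exprM mulnC exprM.
  rewrite !sqr_sqrtr// ?divr_ge0 ?(ltW l0)//.
  rewrite mulrAC ler_pdivlMr// mulrC.
  have -> : mxword A s i j = ((mxword A s)^T *m e i) j 0.
    by rewrite -colE !mxE.
  apply: le_trans (lP _ j) _; rewrite -qform_congr.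
  apply: le_trans (mxword_contraction feas tau0 s (e i)) _.
  rewrite mulrC ler_wpM2r ?exprn_ge0//.
  by rewrite /Q (bigD1 i)//= lerDl sumr_ge0.
apply/lee_addgt0Pr => d d0.
have [K KP] := geometric_domination (C * Num.sqrt (Q / l)) (sqrtr_ge0 tau)
  (ltr_pwDr d0 (lexx (Num.sqrt tau))).
apply: (@limn_esup_le_eventually _ _ _ K.+1) => k Kk; rewrite -EFinD lee_fin.
apply/jsr_seq_leP; first exact: leq_ltn_trans Kk.
  by rewrite addr_ge0 ?sqrtr_ge0 ?ltW.
move=> s sk; apply: le_trans (word_le s) _; rewrite sk.
by apply: KP; exact: ltnW.
Qed.

(** The gap between [a] and [c] absorbs the constant that relates [N] to the
    Euclidean norm; the radius below [a] gives [N W <= a ^ k] for all long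
    enough words [W]. *)
Lemma feasible_of_jsr_lt a c : (0 < m)%N -> 0 < a -> a < c ->
  (joint_spectral_radius N A < a%:E)%E ->
  exists X, ellipsoid_feasible A X (m%:R * c ^+ 2).
Proof.
move=> m0 a0 ac /limn_esup_lt_eventually [K1 K1P].
have c0 : 0 < c by exact: lt_trans ac.
have [D D0 DP] := entries_le_matrix_norm normN.
have a2c2 : a ^+ 2 < c ^+ 2 by rewrite ltrXn2r ?(ltW a0).
have [K2 K2P] := geometric_domination (n%:R ^+ 3 * D ^+ 2) (sqr_ge0 a) a2c2.
pose K := maxn K1 K2.
exists (\sum_(k < K.+1) (m%:R * c ^+ 2) ^- k *: iter k (ellipsoid_op A) 1%:M).
apply: partial_resolvent_feasible.
  by rewrite mulr_gt0 ?exprn_gt0// ltr0n.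
move=> x; rewrite exprMn -mulrA; apply: iter_ellipsoid_op_le => s sK.
have Nle : N (mxword A s) <= a ^+ K.+1.
  apply: (iffLR (jsr_seq_leP (ltn0Sn K) (ltW a0))) sK.
  by rewrite -lee_fin ltW// K1P// leqW// leq_maxl.
apply: le_trans (qform1_le_entries (b := D * a ^+ K.+1) _ _) _.
  by move=> i j; apply: le_trans (DP _ _ _) _; rewrite ler_wpM2l.
rewrite ler_wpM2r//.
  by rewrite qform1 sumr_ge0// => i _; exact: sqr_ge0.
by rewrite exprMn mulrA -exprM mulnC exprM K2P// leqW// leq_maxr.
Qed.

End jsr.

Theorem theorem8 (R : realType) (n m : nat) (n_gt0 : (0 < n)%N)
    (m_gt0 : (0 < m)%N) (A : 'I_m -> 'M[R]_n) (N : 'M[R]_n -> R)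
    (normN : is_matrix_norm N) :
  (((Num.sqrt m%:R)^-1)%:E * ellipsoid_approx A
     <= joint_spectral_radius N A)%E /\
  (joint_spectral_radius N A <= ellipsoid_approx A)%E.
Proof.
have jsr0 := jsr_ge0 N A.
split; last first.
  (* Compare squares, since the infimum is under the square root. *)
  rewrite -[leLHS]gee0_abs// -sqrte_sqr lee_sqrt; last first.
    apply: le_ereal_inf_tmp => _ [tau [X feas] <-]; rewrite lee_fin.
    exact: feasible_ge0 feas.
  apply: le_ereal_inf_tmp => _ [tau [X feas] <-].
  have tau0 := feasible_ge0 n_gt0 m_gt0 feas.
  rewrite -[tau]sqr_sqrtr// EFin_expe.
  by rewrite lee_sqr ?lee_fin ?sqrtr_ge0// (jsr_le_sqrt_feasible normN feas).
have sm0 : 0 < Num.sqrt m%:R :> R by rewrite sqrtr_gt0 ltr0n.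
case jsrE : (joint_spectral_radius N A) => [r| |]; last 2 first.
- by rewrite leey.
- by rewrite jsrE in jsr0.
have r0 : 0 <= r by rewrite -lee_fin -jsrE.
apply/lee_addgt0Pr => e e0.
rewrite -EFinD lee_pdivrMl//.
have [X feas] : exists X, ellipsoid_feasible A X (m%:R * (r + e) ^+ 2).
  apply: (@feasible_of_jsr_lt _ _ _ N _ normN (r + e / 2)) => //; [lra|lra|].
  by rewrite jsrE lte_fin; lra.
have -> : ((Num.sqrt m%:R)%:E * (r + e)%:E)%E
    = sqrte (m%:R * (r + e) ^+ 2)%:E :> \bar R.
  by rewrite /= sqrtrM// sqrtr_sqr ger0_norm ?addr_ge0// ltW.
rewrite lee_sqrt; last by rewrite lee_fin mulr_ge0 ?sqr_ge0.
apply: ereal_inf_lbound; exists (m%:R * (r + e) ^+ 2) => //.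
by exists X.
Qed.
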